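(* Let $R$ be a ring. The following are equivalent: (1) $R$ has property $( * )$, i.e. there exist a Noetherian ring $S$ and a flat ring map $R \to S$; (2) $R_{\mathfrak{p}}$ is Noetherian for some $\mathfrak{p} \in \operatorname{Spec} R$; (3) $R_{\mathfrak{p}}$ is Artinian for some $\mathfrak{p} \in \operatorname{Min} R$.
   Context: All rings are commutative with $1 \neq 0$ (in particular nonzero), and ring maps take $1$ to $1$. A ring map $R \to S$ is flat if $S$ is flat as an $R$-module. $\operatorname{Min} R$ denotes the set of minimal primes of $R$. *)

(* Defs.v *)
From HB Require Import structures.
From mathcomp Require Import all_boot all_algebra boolp ring.

Set Implicit Arguments.
Unset Strict Implicit.
Unset Printing Implicit Defensive.

Import GRing.Theory.
Local Open Scope ring_scope.
Local Open Scope quotient_scope.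

(* Ideals are boolean predicates.  Since [boolp] is classical, every Prop-valued
   subset is of this form, so no decidability restriction is being imposed; in
   particular [prime_idealr R] is Spec R.  The [idealr] of [ring_quotient] are
   proper by definition, hence [is_ideal] for arbitrary ideals. *)
Definition is_ideal (R : comNzRingType) (I : {pred R}) : Prop :=
  GRing.submod_closed (I : {pred R^o}).

Definition generates (R : comNzRingType) (s : seq R) (I : {pred R}) : Prop :=
  forall x, x \in I <-> exists c : 'I_(size s) -> R, x = \sum_i c i * s`_i.

Definition noetherian (R : comNzRingType) : Prop :=
  forall I : {pred R}, is_ideal I -> exists s : seq R, generates s I.

Definition artinian (R : comNzRingType) : Prop :=
  forall I : nat -> {pred R},
    (forall n, is_ideal (I n)) -> (forall n, {subset I n.+1 <= I n}) ->
    exists N, forall n, (N <= n)%N -> I n =i I N.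

Definition minimal_prime (R : comNzRingType) (p : prime_idealr R) : Prop :=
  forall q : prime_idealr R, {subset q <= p} -> q =i p.

Section Localization.
Variables (R : comNzRingType) (p : prime_idealr R).

Definition denom : Type := {s : R | s \notin p}.
Definition fracs : Type := (R * denom)%type.

Implicit Types (s t u : denom) (x y z : fracs).

Fact denom1_subproof : 1 \notin p.
Proof. by rewrite idealr1. Qed.
Definition denom1 : denom := exist _ 1 denom1_subproof.

Fact denomM_subproof s t : sval s * sval t \notin p.
Proof. by rewrite prime_idealrM negb_or (svalP s) (svalP t). Qed.
Definition denomM s t : denom := exist _ (sval s * sval t) (denomM_subproof s t).

(* The factor [u] is needed because [R] may have zero divisors. *)
Definition fracs_eq x y : Prop :=
  exists u : denom, sval u * (x.1 * sval y.2) = sval u * (y.1 * sval x.2).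

Definition fracs_eqb x y : bool := `[< fracs_eq x y >].

Fact fracs_eqb_refl : reflexive fracs_eqb.
Proof. by move=> x; apply/asboolP; exists denom1. Qed.

Fact fracs_eqb_sym : symmetric fracs_eqb.
Proof. by move=> x y; apply/asboolP/asboolP => -[u e]; exists u. Qed.

Fact fracs_eqb_trans : transitive fracs_eqb.
Proof.
move=> y x z /asboolP [u e1] /asboolP [v e2]; apply/asboolP.
exists (denomM (denomM u v) y.2) => /=.
transitivity ((sval u * (x.1 * sval y.2)) * (sval v * sval z.2)); first by ring.
rewrite e1.
transitivity ((sval v * (y.1 * sval z.2)) * (sval u * sval x.2)); first by ring.
by rewrite e2; ring.
Qed.

Canonical fracs_equiv :=
  EquivRel fracs_eqb fracs_eqb_refl fracs_eqb_sym fracs_eqb_trans.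

Definition localization : Type := {eq_quot fracs_eqb}.
HB.instance Definition _ : EqQuotient _ fracs_eqb localization :=
  EqQuotient.on localization.
HB.instance Definition _ := Choice.on localization.

Lemma eq_localization x y :
  fracs_eq x y <-> \pi_localization x = \pi_localization y.
Proof. by split=> [e|/eqmodP/asboolP//]; apply/eqmodP/asboolP. Qed.

Definition frac_add x y : fracs :=
  (x.1 * sval y.2 + y.1 * sval x.2, denomM x.2 y.2).
Definition frac_opp x : fracs := (- x.1, x.2).
Definition frac_mul x y : fracs := (x.1 * y.1, denomM x.2 y.2).

Definition loc_zero : localization := \pi_localization (0, denom1).
Definition loc_one : localization := \pi_localization (1, denom1).
Definition loc_add := lift_op2 localization frac_add.
Definition loc_opp := lift_op1 localization frac_opp.
Definition loc_mul := lift_op2 localization frac_mul.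

Fact repr_fracs_eq x : fracs_eq (repr (\pi_localization x)) x.
Proof. by apply/eq_localization; rewrite reprK. Qed.

Fact pi_loc_add : {morph \pi_localization : x y / frac_add x y >-> loc_add x y}.
Proof.
move=> x y; unlock loc_add; apply/eq_localization.
case: (repr_fracs_eq x); move: (repr _) => x' u e1.
case: (repr_fracs_eq y); move: (repr _) => y' v e2.
exists (denomM u v) => /=.
transitivity ((sval u * (x.1 * sval x'.2)) * (sval v * sval y.2 * sval y'.2) +
  (sval v * (y.1 * sval y'.2)) * (sval u * sval x.2 * sval x'.2)); first by ring.
by rewrite -e1 -e2; ring.
Qed.

Fact pi_loc_opp : {morph \pi_localization : x / frac_opp x >-> loc_opp x}.
Proof.
move=> x; unlock loc_opp; apply/eq_localization.
case: (repr_fracs_eq x); move: (repr _) => x' u e; exists u => /=.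
by rewrite !mulNr !mulrN e.
Qed.

Fact pi_loc_mul : {morph \pi_localization : x y / frac_mul x y >-> loc_mul x y}.
Proof.
move=> x y; unlock loc_mul; apply/eq_localization.
case: (repr_fracs_eq x); move: (repr _) => x' u e1.
case: (repr_fracs_eq y); move: (repr _) => y' v e2.
exists (denomM u v) => /=.
transitivity ((sval u * (x.1 * sval x'.2)) * (sval v * (y.1 * sval y'.2)));
  first by ring.
by rewrite -e1 -e2; ring.
Qed.

Fact loc_addA : associative loc_add.
Proof.
elim/quotW=> x; elim/quotW=> y; elim/quotW=> z; rewrite -!pi_loc_add.
by apply/eq_localization; exists denom1 => /=; ring.
Qed.

Fact loc_addC : commutative loc_add.
Proof.
elim/quotW=> x; elim/quotW=> y; rewrite -!pi_loc_add.
by apply/eq_localization; exists denom1 => /=; ring.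
Qed.

Fact loc_add0 : left_id loc_zero loc_add.
Proof.
elim/quotW=> x; rewrite -!pi_loc_add.
by apply/eq_localization; exists denom1 => /=; ring.
Qed.

Fact loc_addN : left_inverse loc_zero loc_opp loc_add.
Proof.
elim/quotW=> x; rewrite -pi_loc_opp -pi_loc_add.
by apply/eq_localization; exists denom1 => /=; ring.
Qed.

HB.instance Definition _ :=
  GRing.isZmodule.Build localization loc_addA loc_addC loc_add0 loc_addN.

Fact loc_mulA : associative loc_mul.
Proof.
elim/quotW=> x; elim/quotW=> y; elim/quotW=> z; rewrite -!pi_loc_mul.
by apply/eq_localization; exists denom1 => /=; ring.
Qed.

Fact loc_mulC : commutative loc_mul.
Proof.
elim/quotW=> x; elim/quotW=> y; rewrite -!pi_loc_mul.
by apply/eq_localization; exists denom1 => /=; ring.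
Qed.

Fact loc_mul1 : left_id loc_one loc_mul.
Proof.
elim/quotW=> x; rewrite -!pi_loc_mul.
by apply/eq_localization; exists denom1 => /=; ring.
Qed.

Fact loc_mulDl : left_distributive loc_mul loc_add.
Proof.
elim/quotW=> x; elim/quotW=> y; elim/quotW=> z.
rewrite -pi_loc_add -!pi_loc_mul -pi_loc_add.
by apply/eq_localization; exists denom1 => /=; ring.
Qed.

Fact loc_one_neq0 : loc_one != loc_zero.
Proof.
apply/eqP => /eq_localization [u] /=; rewrite mul0r mulr0 !mulr1 => u0.
by have := svalP u; rewrite u0 idealr0.
Qed.

HB.instance Definition _ := GRing.Zmodule_isComNzRing.Build localization
  loc_mulA loc_mulC loc_mul1 loc_mulDl loc_one_neq0.

End Localization.

Section Tensor.
Variables (R : comNzRingType) (M N : lmodType R).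

(* A list of pairs stands for the formal sum of the corresponding elementary
   tensors, so that lists up to [tensor_eq] are the quotient of the free
   commutative monoid on M * N by the bilinearity relations.  Because of
   [tensor_eq0l], this monoid is already a group, with -(m (x) n) = (-m) (x) n. *)
Inductive tensor_eq : seq (M * N) -> seq (M * N) -> Prop :=
| tensor_eq_refl s : tensor_eq s s
| tensor_eq_sym s t : tensor_eq s t -> tensor_eq t s
| tensor_eq_trans t s u : tensor_eq s t -> tensor_eq t u -> tensor_eq s u
| tensor_eq_cat s s' t t' :
    tensor_eq s s' -> tensor_eq t t' -> tensor_eq (s ++ t) (s' ++ t')
| tensor_eq_catC s t : tensor_eq (s ++ t) (t ++ s)
| tensor_eq0l n : tensor_eq [:: (0, n)] [::]
| tensor_eqDl m m' n : tensor_eq [:: (m + m', n)] [:: (m, n); (m', n)]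
| tensor_eqDr m n n' : tensor_eq [:: (m, n + n')] [:: (m, n); (m, n')]
| tensor_eqZ a m n : tensor_eq [:: (a *: m, n)] [:: (m, a *: n)].

Definition tensor_eqb s t : bool := `[< tensor_eq s t >].

Fact tensor_eqb_refl : reflexive tensor_eqb.
Proof. by move=> s; apply/asboolP; exact: tensor_eq_refl. Qed.

Fact tensor_eqb_sym : symmetric tensor_eqb.
Proof. by move=> s t; apply/asboolP/asboolP; exact: tensor_eq_sym. Qed.

Fact tensor_eqb_trans : transitive tensor_eqb.
Proof.
by move=> t s u /asboolP st /asboolP tu; apply/asboolP; exact: tensor_eq_trans tu.
Qed.

Canonical tensor_equiv :=
  EquivRel tensor_eqb tensor_eqb_refl tensor_eqb_sym tensor_eqb_trans.

Definition tensor : Type := {eq_quot tensor_eqb}.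
HB.instance Definition _ : EqQuotient _ tensor_eqb tensor :=
  EqQuotient.on tensor.
HB.instance Definition _ := Choice.on tensor.

Lemma eq_tensor s t : tensor_eq s t <-> \pi_tensor s = \pi_tensor t.
Proof. by split=> [e|/eqmodP/asboolP//]; apply/eqmodP/asboolP. Qed.

Fact repr_tensor_eq s : tensor_eq (repr (\pi_tensor s)) s.
Proof. by apply/eq_tensor; rewrite reprK. Qed.

Definition formal_scale (a : R) (s : seq (M * N)) : seq (M * N) :=
  [seq (a *: x.1, x.2) | x <- s].

Fact formal_scale_eq a s t :
  tensor_eq s t -> tensor_eq (formal_scale a s) (formal_scale a t).
Proof.
elim=> {s t} [s|s t _|t s u _ IH1 _|s s' t t' _ IH1 _ IH2|s t|n|m m' n|m n n'|b m n].
- exact: tensor_eq_refl.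
- exact: tensor_eq_sym.
- exact: tensor_eq_trans.
- by rewrite /formal_scale !map_cat; exact: tensor_eq_cat.
- by rewrite /formal_scale !map_cat; exact: tensor_eq_catC.
- by rewrite /= scaler0; exact: tensor_eq0l.
- by rewrite /= scalerDr; exact: tensor_eqDl.
- exact: tensor_eqDr.
- by rewrite /= scalerA mulrC -scalerA; exact: tensor_eqZ.
Qed.

Definition tensor_zero : tensor := \pi_tensor [::].
Definition tensor_add := lift_op2 tensor (@cat (M * N)).
Definition tensor_opp := lift_op1 tensor (formal_scale (-1)).
Definition tensor_scale (a : R) := lift_op1 tensor (formal_scale a).

Fact pi_tensor_add : {morph \pi_tensor : s t / s ++ t >-> tensor_add s t}.
Proof.
move=> s t; unlock tensor_add; apply/eq_tensor/tensor_eq_cat;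
  exact/tensor_eq_sym/repr_tensor_eq.
Qed.

Fact pi_tensor_scale a :
  {morph \pi_tensor : s / formal_scale a s >-> tensor_scale a s}.
Proof.
move=> s; unlock tensor_scale; apply/eq_tensor/formal_scale_eq.
exact/tensor_eq_sym/repr_tensor_eq.
Qed.

Fact tensor_addA : associative tensor_add.
Proof.
elim/quotW=> s; elim/quotW=> t; elim/quotW=> u.
by rewrite -!pi_tensor_add catA.
Qed.

Fact tensor_addC : commutative tensor_add.
Proof.
elim/quotW=> s; elim/quotW=> t; rewrite -!pi_tensor_add.
exact/eq_tensor/tensor_eq_catC.
Qed.

Fact tensor_add0 : left_id tensor_zero tensor_add.
Proof. by elim/quotW=> s; rewrite -pi_tensor_add. Qed.

Fact tensor_scaleDl : forall v a b,
  tensor_scale (a + b) v = tensor_add (tensor_scale a v) (tensor_scale b v).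
Proof.
elim/quotW=> s a b; rewrite -!pi_tensor_scale -pi_tensor_add.
apply/eq_tensor; elim: s => [|[m n] s IHs] /=; first exact: tensor_eq_refl.
rewrite scalerDl -cat1s.
apply: tensor_eq_trans (tensor_eq_cat (tensor_eqDl _ _ _) IHs) _.
rewrite -[_ :: _ ++ _]cat1s -[[:: _, _ & _]]cat1s -catA.
apply: (tensor_eq_cat (tensor_eq_refl _)).
rewrite -[X in tensor_eq _ (_ ++ X)]cat1s !catA.
exact: tensor_eq_cat (tensor_eq_catC _ _) (tensor_eq_refl _).
Qed.

Fact tensor_scale1 : left_id 1 tensor_scale.
Proof.
elim/quotW=> s; rewrite -pi_tensor_scale; congr (\pi_tensor _).
by elim: s => [|[m n] s IHs] //=; rewrite IHs scale1r.
Qed.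

Fact tensor_scale0 v : tensor_scale 0 v = tensor_zero.
Proof.
elim/quotW: v => s; rewrite -pi_tensor_scale; apply/eq_tensor.
elim: s => [|[m n] s IHs] /=; first exact: tensor_eq_refl.
rewrite scale0r -cat1s -[[::]]cats0.
exact: tensor_eq_cat (tensor_eq0l _) IHs.
Qed.

Fact tensor_addN : left_inverse tensor_zero tensor_opp tensor_add.
Proof.
by move=> v; rewrite -{2}[v]tensor_scale1 -tensor_scaleDl addNr tensor_scale0.
Qed.

HB.instance Definition _ := GRing.isZmodule.Build tensor
  tensor_addA tensor_addC tensor_add0 tensor_addN.

Fact tensor_scaleA a b v :
  tensor_scale a (tensor_scale b v) = tensor_scale (a * b) v.
Proof.
elim/quotW: v => s; rewrite -!pi_tensor_scale; congr (\pi_tensor _).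
by rewrite /formal_scale -map_comp; apply: eq_map => x /=; rewrite scalerA.
Qed.

Fact tensor_scaleDr : right_distributive tensor_scale +%R.
Proof.
move=> a; elim/quotW=> s; elim/quotW=> t.
transitivity (tensor_scale a (\pi_tensor (s ++ t))); first by rewrite pi_tensor_add.
by rewrite -pi_tensor_scale /formal_scale map_cat pi_tensor_add !pi_tensor_scale.
Qed.

HB.instance Definition _ := GRing.Zmodule_isLmodule.Build R tensor
  tensor_scaleA tensor_scale1 tensor_scaleDr (fun v a b => tensor_scaleDl v a b).

End Tensor.

Section TensorMap.
Variables (R : comNzRingType) (M M' N : lmodType R) (f : {linear M -> M'}).

Definition formal_map (s : seq (M * N)) : seq (M' * N) :=
  [seq (f x.1, x.2) | x <- s].

(* f (x) id_N *)
Definition tensor_map (v : tensor M N) : tensor M' N :=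
  \pi_(tensor M' N) (formal_map (repr v)).

Lemma tensor_mapE s :
  tensor_map (\pi_(tensor M N) s) = \pi_(tensor M' N) (formal_map s).
Proof.
apply/eq_tensor; move: (repr _) (repr_tensor_eq s) => r.
elim=> {r s} [s|s t _|t s u _ IH1 _|s s' t t' _ IH1 _ IH2|s t|n|m m' n|m n n'|a m n].
- exact: tensor_eq_refl.
- exact: tensor_eq_sym.
- exact: tensor_eq_trans.
- by rewrite /formal_map !map_cat; exact: tensor_eq_cat.
- by rewrite /formal_map !map_cat; exact: tensor_eq_catC.
- by rewrite /= linear0; exact: tensor_eq0l.
- by rewrite /= linearD; exact: tensor_eqDl.
- exact: tensor_eqDr.
- by rewrite /= linearZ; exact: tensor_eqZ.
Qed.

Fact tensor_map_is_linear : linear tensor_map.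
Proof.
move=> a; elim/quotW=> s; elim/quotW=> t.
transitivity (tensor_map (\pi_(tensor M N) (formal_scale a s ++ t))).
  by rewrite pi_tensor_add pi_tensor_scale.
rewrite !tensor_mapE.
transitivity (\pi_(tensor M' N) (formal_scale a (formal_map s) ++ formal_map t));
  last by rewrite pi_tensor_add pi_tensor_scale.
congr (\pi_(tensor M' N) _).
rewrite /formal_map /formal_scale map_cat -!map_comp; congr (_ ++ _).
by apply: eq_map => x /=; rewrite linearZ.
Qed.

HB.instance Definition _ :=
  GRing.isLinear.Build R (tensor M N) (tensor M' N) *:%R tensor_map
    tensor_map_is_linear.

End TensorMap.

Arguments tensor_map {R M M'} N f v.

Definition exact_at (R : comNzRingType) (M1 M2 M3 : lmodType R)
    (f : {linear M1 -> M2}) (g : {linear M2 -> M3}) : Prop :=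
  forall y : M2, g y = 0 <-> exists x : M1, y = f x.

Definition flat (R : comNzRingType) (N : lmodType R) : Prop :=
  forall (M1 M2 M3 : lmodType R) (f : {linear M1 -> M2}) (g : {linear M2 -> M3}),
    exact_at f g -> exact_at (tensor_map N f) (tensor_map N g).

(* S regarded as an R-module through phi; the type mentions phi so that it can
   carry the module structure. *)
Definition restriction (R S : comNzRingType) (phi : {rmorphism R -> S}) : Type := S.

Section RestrictionOfScalars.
Variables (R S : comNzRingType) (phi : {rmorphism R -> S}).

HB.instance Definition _ := GRing.Zmodule.copy (restriction phi) S.

Definition restriction_scale (a : R) (x : restriction phi) : restriction phi :=
  (phi a * (x : S) : S).

Fact restriction_scaleA a b v :
  restriction_scale a (restriction_scale b v) = restriction_scale (a * b) v.
Proof. by rewrite /restriction_scale rmorphM mulrA. Qed.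

Fact restriction_scale1 : left_id 1 restriction_scale.
Proof. by move=> v; rewrite /restriction_scale rmorph1 mul1r. Qed.

Fact restriction_scaleDr : right_distributive restriction_scale +%R.
Proof. by move=> a u v; exact: mulrDr. Qed.

Fact restriction_scaleDl v :
  {morph restriction_scale^~ v : a b / a + b}.
Proof. by move=> a b; rewrite /restriction_scale rmorphD; exact: mulrDl. Qed.

HB.instance Definition _ := GRing.Zmodule_isLmodule.Build R (restriction phi)
  restriction_scaleA restriction_scale1 restriction_scaleDr restriction_scaleDl.

End RestrictionOfScalars.

Definition flat_map (R S : comNzRingType) (phi : {rmorphism R -> S}) : Prop :=
  flat (restriction phi).

Definition property_star (R : comNzRingType) : Prop :=
  exists (S : comNzRingType) (phi : {rmorphism R -> S}),
    noetherian S /\ flat_map phi.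

(* Main.v *)
Require Import Defs.
From mathcomp Require Import all_boot all_algebra.
From HB Require Import structures.
From mathcomp Require Import boolp classical_sets ring.

(** A flat map R -> S into a Noetherian ring forces some localization of R to be
    Noetherian, because flatness transports linear equations.  Take a prime Q of
    S and its contraction p.  If x and a_1, ..., a_n are elements of R and phi x
    lies in the ideal of S generated by the phi a_i, then the elements b of R
    with b x in (a_1, ..., a_n) generate the unit ideal of S
    ([flat_transporter]), so one of them is outside p and x lies in
    (a_1, ..., a_n) R_p.  As the extension to S of an ideal J of R is generated
    by finitely many images of elements of J, those elements generate J R_p
    ([noetherian_localization_of_star]).

    If R_p is Noetherian, let q be a minimal prime contained in p.  Then R_q is
    a further localization of R_p, hence Noetherian, and its only prime is its
    maximal ideal.  A Noetherian ring whose primes are all maximal is Artinian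
    ([noetherian_artinian]), by Noetherian induction on the ideals J for which
    R / J fails to be Artinian.

    Conversely an Artinian ring is Noetherian ([artinian_noetherian]), by the
    dual induction on the ideals that fail to be finitely generated, and
    R -> R_p is flat ([flat_localization]), so S = R_p will do.

    No quotient ring occurs: statements about R / J are made about the ideals of
    R that contain J, and statements about ideals of R_p about their
    contractions to R. *)

Set Implicit Arguments.
Unset Strict Implicit.
Unset Printing Implicit Defensive.

Import GRing.Theory.
Local Open Scope ring_scope.
Local Open Scope quotient_scope.

(** * Ideals, spans and primes *)

Lemma seq_lift (T U : eqType) (f : T -> U) (P : T -> Prop) (s : seq U) :
  (forall y, y \in s -> exists2 x, P x & y = f x) ->
  exists2 t : seq T, (forall x, x \in t -> P x) & s = map f t.
Proof.
elim: s => [|y s IHs] imP; first by exists [::].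
have [x Px ->] := imP y (mem_head _ _).
have [|t Pt ->] := IHs; first by move=> z zs; apply: imP; rewrite inE zs orbT.
exists (x :: t) => // z; rewrite inE => /predU1P[->//|]; exact: Pt.
Qed.

Section Ideals.
Variable R : comNzRingType.
Implicit Types (I J K : {pred R}) (s t : seq R) (a b c x y : R).

Lemma is_idealP I : is_ideal I <->
  [/\ 0 \in I, forall x y, x \in I -> y \in I -> x + y \in I
    & forall a x, x \in I -> a * x \in I].
Proof.
split=> [[I0 Ilin]|[I0 ID IM]].
  split=> // [x y Ix Iy|a x Ix].
    by have := Ilin 1 x y Ix Iy; rewrite scale1r.
  by have := Ilin a x 0 Ix I0; rewrite addr0.
by split=> // a x y Ix Iy; apply: ID => //; apply: IM.
Qed.

Lemma ideal0 I : is_ideal I -> 0 \in I. Proof. by case/is_idealP. Qed.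
Lemma idealD I x y : is_ideal I -> x \in I -> y \in I -> x + y \in I.
Proof. by case/is_idealP => _ + _; apply. Qed.
Lemma idealM a I x : is_ideal I -> x \in I -> a * x \in I.
Proof. by case/is_idealP => _ _; apply. Qed.
Lemma idealB I x y : is_ideal I -> x \in I -> y \in I -> x - y \in I.
Proof. by move=> iI Ix Iy; rewrite -mulN1r idealD // idealM. Qed.

Definition pred_of (P : R -> Prop) : {pred R} := fun x => `[< P x >].

Lemma pred_ofP (P : R -> Prop) x : reflect (P x) (x \in pred_of P).
Proof. exact: asboolP. Qed.

Lemma is_ideal_pred_of (P : R -> Prop) :
  P 0 -> (forall x y, P x -> P y -> P (x + y)) ->
  (forall a x, P x -> P (a * x)) -> is_ideal (pred_of P).
Proof.
move=> P0 PD PM; apply/is_idealP; split; first exact/pred_ofP.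
- by move=> x y /pred_ofP Px /pred_ofP Py; apply/pred_ofP/PD.
- by move=> a x /pred_ofP Px; apply/pred_ofP/PM.
Qed.

Definition span s : {pred R} :=
  pred_of (fun x => exists c : 'I_(size s) -> R, x = \sum_i c i * s`_i).

Lemma spanP s x :
  reflect (exists c : 'I_(size s) -> R, x = \sum_i c i * s`_i) (x \in span s).
Proof. exact: pred_ofP. Qed.

Lemma is_ideal_span s : is_ideal (span s).
Proof.
apply: is_ideal_pred_of.
- by exists (fun=> 0); rewrite big1 // => i _; rewrite mul0r.
- move=> _ _ [c ->] [d ->]; exists (fun i => c i + d i); rewrite -big_split.
  by apply: eq_bigr => i _ /=; rewrite mulrDl.
- move=> a _ [c ->]; exists (fun i => a * c i); rewrite big_distrr.
  by apply: eq_bigr => i _ /=; rewrite mulrA.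
Qed.

Lemma span_min s I : is_ideal I -> {subset s <= I} -> {subset span s <= I}.
Proof.
move=> iI sI _ /spanP[c ->]; apply: (big_ind (fun x => x \in I)).
- exact: ideal0.
- by move=> x y; apply: idealD.
- by move=> i _; apply/idealM/sI/mem_nth.
Qed.

Lemma mem_span s : {subset s <= span s}.
Proof.
move=> x xs; have xs' := xs; rewrite -index_mem in xs'.
apply/spanP; exists (fun i => (i == Ordinal xs')%:R).
rewrite (bigD1 (Ordinal xs')) //= eqxx mul1r nth_index // big1 ?addr0 //.
by move=> i /negPf->; rewrite mul0r.
Qed.

Lemma sub_span s t : {subset s <= t} -> {subset span s <= span t}.
Proof.
move=> st; apply: span_min; first exact: is_ideal_span.
by move=> x /st; apply: mem_span.
Qed.

Lemma span_nil x : x \in span [::] -> x = 0.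
Proof. by case/spanP => c ->; rewrite big_ord0. Qed.

Lemma span_cons a s x : x \in span (a :: s) <-> exists c, x - c * a \in span s.
Proof.
split=> [/spanP[c ->]|[c sx]].
  exists (c ord0); rewrite big_ord_recl addrC addKr; apply/spanP.
  by exists (fun i => c (lift ord0 i)).
rewrite -[x](subrK (c * a)); apply: idealD; first exact: is_ideal_span.
  by apply: sub_span sx => y ys; rewrite inE ys orbT.
by apply: idealM (is_ideal_span _) (mem_span (mem_head _ _)).
Qed.

Lemma generatesP s I : is_ideal I ->
  generates s I <-> {subset s <= I} /\ {subset I <= span s}.
Proof.
move=> iI; split=> [gI|[sI Is] x].
  split=> x; last by move=> /gI sx; apply/spanP.
  by move=> /mem_span/spanP/gI.
split=> [/Is/spanP//|/spanP]; exact: span_min.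
Qed.

(** The span of an arbitrary subset P is the union of the spans of the finite
    lists of elements of P.  A finite generating list of that ideal therefore
    lies in the span of one such list.  This lets generators of an extended
    ideal be chosen in the image of the original ideal. *)
Lemma noetherian_generated : noetherian R ->
  forall P : R -> Prop, exists2 s,
    (forall x, x \in s -> P x) & (forall x, P x -> x \in span s).
Proof.
move=> nR P.
pose Q x := exists2 s, (forall y, y \in s -> P y) & x \in span s.
have QM a x : Q x -> Q (a * x).
  by case=> s sP xs; exists s => //; apply: idealM xs; apply: is_ideal_span.
have QD x y : Q x -> Q y -> Q (x + y).
  case=> [s sP xs] [t tP yt]; exists (s ++ t).
    by move=> z; rewrite mem_cat => /orP[/sP|/tP].
  apply: idealD (is_ideal_span _) _ _.
    by apply: sub_span xs => z; rewrite mem_cat => ->.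
  by apply: sub_span yt => z; rewrite mem_cat orbC => ->.
have iQ : is_ideal (pred_of Q).
  by apply: is_ideal_pred_of => //; exists [::] => //; apply: ideal0 (is_ideal_span _).
have [t /(generatesP _ iQ)[tQ Qt]] := nR _ iQ.
have [s sP ts] : exists2 s, (forall y, y \in s -> P y) & {subset t <= span s}.
  elim: t tQ {Qt} => [|y t IHt] tQ; first by exists [::].
  have [|s sP ts] := IHt; first by move=> z zt; apply: tQ; rewrite inE zt orbT.
  have [s' s'P ys'] := pred_ofP Q y (tQ y (mem_head _ _)).
  exists (s' ++ s) => [z|z]; first by rewrite mem_cat => /orP[/s'P|/sP].
  rewrite inE => /predU1P[->|/ts].
    by apply: sub_span ys' => u; rewrite mem_cat => ->.
  by apply: sub_span => u; rewrite mem_cat orbC => ->.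
exists s => // x Px; apply: (span_min (is_ideal_span s) ts); apply: Qt.
apply/pred_ofP; exists [:: x]; last by apply: mem_span; rewrite mem_head.
by move=> y; rewrite inE => /eqP->.
Qed.

Definition proper_prime I :=
  [/\ is_ideal I, 1 \notin I & forall a b, a * b \in I -> a \in I \/ b \in I].

Lemma proper_prime_idealr (p : prime_idealr R) : proper_prime p.
Proof.
split.
- apply/is_idealP; split; first exact: idealr0.
    by move=> x y; apply: rpredD.
  by move=> a x; apply: idealMr.
- by rewrite idealr1.
- by move=> a b; rewrite prime_idealrM => /orP.
Qed.

Lemma prime_idealr_of I : proper_prime I -> exists p : prime_idealr R, p =i I.
Proof.
case=> iI I1 IM.
have cI : idealr_closed I.
  split=> //; first exact: ideal0.
  by move=> a x y Ix Iy; rewrite idealD // idealM.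
have pI : prime_idealr_closed I.
  by move=> a b /IM[->//|->]; rewrite orbT.
pose F := isIdealr.Build R I cI.
pose G := isPrimeIdealrClosed.Build R I pI.
by exists (HB.pack_for (prime_idealr R) (I : R -> bool) F G).
Qed.

Definition ideal_add J a := pred_of (fun x => exists c, x - c * a \in J).
Definition ideal_colon J a := pred_of (fun x => x * a \in J).

Lemma is_ideal_add J a : is_ideal J -> is_ideal (ideal_add J a).
Proof.
move=> iJ; apply: is_ideal_pred_of.
- by exists 0; rewrite mul0r subr0 ideal0.
- by move=> x y [d Kx] [e Ky]; exists (d + e); rewrite mulrDl opprD addrACA idealD.
- by move=> e x [d Kx]; exists (e * d); rewrite -mulrA -mulrBr idealM.
Qed.

Lemma sub_ideal_add J a : {subset J <= ideal_add J a}.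
Proof. by move=> x Jx; apply/pred_ofP; exists 0; rewrite mul0r subr0. Qed.

Lemma mem_ideal_add J a : is_ideal J -> a \in ideal_add J a.
Proof. by move=> iJ; apply/pred_ofP; exists 1; rewrite mul1r subrr ideal0. Qed.

Lemma ideal_addS I J a : {subset I <= J} -> {subset ideal_add I a <= ideal_add J a}.
Proof. by move=> IJ x /pred_ofP[c /IJ Jx]; apply/pred_ofP; exists c. Qed.

Lemma is_ideal_colon J a : is_ideal J -> is_ideal (ideal_colon J a).
Proof.
move=> iJ; apply: is_ideal_pred_of.
- by rewrite mul0r ideal0.
- by move=> x y Jx Jy; rewrite mulrDl idealD.
- by move=> c x Jx; rewrite -mulrA idealM.
Qed.

Lemma sub_ideal_colon J a : is_ideal J -> {subset J <= ideal_colon J a}.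
Proof. by move=> iJ x Jx; apply/pred_ofP; rewrite mulrC idealM. Qed.

Lemma ideal_colonS I J a :
  {subset I <= J} -> {subset ideal_colon I a <= ideal_colon J a}.
Proof. by move=> IJ x /pred_ofP/IJ Jx; apply/pred_ofP. Qed.

(** Zorn's lemma.  With I the whole ring and x = 1 this yields a maximal ideal;
    with R / Ann I a field it yields a hyperplane of I that misses x. *)
Lemma maximal_avoiding I x : is_ideal I -> x != 0 ->
  exists K, [/\ is_ideal K, {subset K <= I}, x \notin K
    & forall J, is_ideal J -> {subset J <= I} -> {subset K <= J} ->
        x \notin J -> {subset J <= K}].
Proof.
move=> iI x0.
pose P (A : set R) := [/\ (A `<=` [set y | y \in I])%classic, ~ A x
  & forall a y z, A y -> A z -> A (a * y + z)].
have [|A [[AI Ax Alin] maxA]] := @Zorn_bigcup R P.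
  move=> F FP totF; split.
  - by move=> y [X FX Xy]; have [XI _ _] := FP _ FX; apply: XI.
  - by move=> [X FX Xx]; have [_ + _] := FP _ FX; apply.
  - move=> a y z [X FX Xy] [Y FY Yz].
    have [XY|YX] := totF _ _ FX FY.
      by exists Y => //; have [_ _ Ylin] := FP _ FY; apply: Ylin => //; apply: XY.
    by exists X => //; have [_ _ Xlin] := FP _ FX; apply: Xlin => //; apply: YX.
have {}maxA J : is_ideal J -> {subset J <= I} -> (A `<=` [set y | y \in J])%classic ->
    x \notin J -> forall y, y \in J -> A y.
  move=> iJ JI AJ xJ y Jy; apply: contrapT => nAy.
  apply: (maxA [set y | y \in J]%classic).
    by split=> //= JA; apply: nAy; apply: JA.
  split=> //; first by apply/negP.
  by move=> a u v /= Ju Jv; rewrite idealD // idealM.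
(* the union of the empty chain is empty, so P cannot ask for 0; it comes from
   maximality *)
have A0 : A 0.
  apply: contrapT => nA0.
  have nA y : ~ A y.
    by move=> Ay; apply: nA0; rewrite -(addNr y) -mulN1r; apply: Alin.
  apply: nA0; apply: (maxA (span [::])); first exact: is_ideal_span.
  - by move=> y /span_nil->; apply: ideal0.
  - by move=> y /nA.
  - by apply: contra x0 => /span_nil->.
  - exact: ideal0 (is_ideal_span _).
exists (pred_of A); split.
- apply: is_ideal_pred_of => // [y z Ay Az|a y Ay].
    by rewrite -[y]mul1r; apply: Alin.
  by rewrite -[_ * _]addr0; apply: Alin.
- by move=> y /pred_ofP/AI.
- by apply/pred_ofP.
- move=> J iJ JI AJ xJ y Jy; apply/pred_ofP.
  by apply: (maxA J) => // z Az; apply/AJ/pred_ofP.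
Qed.

Lemma exists_prime : exists I, proper_prime I.
Proof.
have iT : is_ideal (predT : {pred R}) by apply/is_idealP; split.
have [K [iK _ K1 maxK]] := maximal_avoiding iT (oner_neq0 R).
exists K; split=> // a b abK; apply: contrapT => /not_orP[/negP aK /negP bK].
have unit_mod c : c \notin K -> exists d, 1 - d * c \in K.
  move=> cK; have [/pred_ofP//|K1c] := boolP (1 \in ideal_add K c).
  case/negP: cK; apply: (maxK (ideal_add K c)) => //.
  - exact: is_ideal_add.
  - exact: sub_ideal_add.
  - exact: mem_ideal_add.
have [d Kd] := unit_mod a aK; have [e Ke] := unit_mod b bK.
case/negP: K1; have -> : 1 = (1 - d * a) + (d * a) * (1 - e * b) + d * e * (a * b).
  by ring.
exact: idealD iK (idealD iK Kd (idealM _ iK Ke)) (idealM _ iK abK).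
Qed.

(** Zorn's lemma for the reverse inclusion: the intersection of a chain of
    primes is prime.  It is applied to the sets A that are removed from I, so
    that the intersection of the chain becomes the union of the removed sets,
    and the empty chain gives I itself. *)
Lemma exists_minimal_prime I : proper_prime I ->
  exists q, [/\ proper_prime q, {subset q <= I}
    & forall J, proper_prime J -> {subset J <= q} -> J =i q].
Proof.
move=> [iI I1 IM].
pose D (A : set R) := pred_of (fun x => x \in I /\ ~ A x).
have DP A x : reflect (x \in I /\ ~ A x) (x \in D A) by apply: pred_ofP.
have [|A [pA maxA]] := @Zorn_bigcup R (fun A => proper_prime (D A)).
  move=> F FP totF; split.
  - apply: is_ideal_pred_of.
    + split=> [|[X FX X0]]; first exact: ideal0.
      by have [iD _ _] := FP _ FX; have /DP[_] := ideal0 iD.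
    + move=> x y [Ix nx] [Iy ny]; split=> [|[X FX Xxy]]; first exact: idealD.
      have [iD _ _] := FP _ FX.
      have /DP[//] : x + y \in D X.
      by apply: idealD => //; apply/DP; split=> // ?; [apply: nx|apply: ny]; exists X.
    + move=> a x [Ix nx]; split=> [|[X FX Xax]]; first exact: idealM.
      have [iD _ _] := FP _ FX.
      have /DP[//] : a * x \in D X.
      by apply: idealM => //; apply/DP; split=> // ?; apply: nx; exists X.
  - by apply: contra I1 => /DP[].
  - move=> a b /DP[Iab nab]; apply: contrapT => /not_orP[na nb].
    have [Ia|Ia] := boolP (a \in I); last first.
      have [//|Ib] := IM _ _ Iab; first exact/negP.
      apply: nb; apply/DP; split=> // -[Y FY Yb].
      have [_ _ DM] := FP _ FY; have [||] := DM a b; last by move=> /DP[].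
        by apply/DP; split=> // Yab; apply: nab; exists Y.
      by move=> /DP[aI]; rewrite aI in Ia.
    have [X FX Xa] : exists2 X, F X & X a.
      by apply: contrapT => h; apply: na; apply/DP.
    (* a member of the chain that removes a must keep b; by totality every
       member then keeps b *)
    have aD Y : F Y -> Y a -> b \in D Y.
      move=> FY Ya; have [_ _ DM] := FP _ FY; have [||//] := DM a b.
        by apply/DP; split=> // Yab; apply: nab; exists Y.
      by move=> /DP[].
    have /DP[Ib _] := aD X FX Xa; apply: nb; apply/DP; split=> // -[Y FY Yb].
    have [XY|YX] := totF _ _ FX FY.
      by have /DP[_] := aD Y FY (XY _ Xa); apply.
    by have /DP[_] := aD X FX Xa; apply; apply: YX.
exists (D A); split=> // [x /DP[]//|J pJ JD x].
apply/idP/idP => [/JD//|Dx]; apply: contrapT => /negP Jx.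
have JE : J =i D [set y | y \notin J]%classic.
  move=> y; apply/idP/DP => [Jy|[_ /negP]]; last by rewrite negbK.
  by split; [have /DP[] := JD _ Jy | apply/negP; rewrite negbK].
apply: (maxA [set y | y \notin J]%classic).
  split=> [y Ay /=|/(_ _ Jx)]; last by have /DP[_] := Dx.
  by apply/negP => /JD/DP[_].
case: pJ => [iJ J1 JM]; split.
- apply/is_idealP; split; first by rewrite -JE ideal0.
    by move=> u v; rewrite -!JE; apply: idealD.
  by move=> u v; rewrite -!JE; apply: idealM.
- by rewrite -JE.
- by move=> u v; rewrite -!JE; apply: JM.
Qed.

(** Otherwise dependent choice gives a strictly ascending sequence of ideals
    with P, and the union of such a sequence is not finitely generated. *)
Lemma noetherian_maximal (P : {pred R} -> Prop) I : noetherian R ->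
  is_ideal I -> P I -> exists J, [/\ is_ideal J, P J
    & forall K, is_ideal K -> P K -> {subset J <= K} -> {subset K <= J}].
Proof.
move=> nR iI PI; apply: contrapT => noJ.
pose T := {J : {pred R} | is_ideal J /\ P J}.
have /choice[next nextP] : forall J : T, exists K : T,
    {subset sval J <= sval K} /\ ~ {subset sval K <= sval J}.
  move=> [J [iJ PJ]]; apply: contrapT => noK; apply: noJ; exists J; split=> //.
  move=> K iK PK JK; apply: contrapT => KJ; apply: noK.
  by exists (exist _ K (conj iK PK)).
pose c n := sval (iter n next (exist _ I (conj iI PI) : T)).
have ic n : is_ideal (c n) by rewrite /c; case: (iter _ _ _) => ? [].
have cS n : {subset c n <= c n.+1} by have [] := nextP (iter n next (exist _ I (conj iI PI))).
have cle m n : (m <= n)%N -> {subset c m <= c n}.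
  move=> /subnK <-; elim: (n - m)%N => // k IHk x /IHk; exact: cS.
have [s sc cs] := noetherian_generated nR (fun x => exists n, x \in c n).
have [N sN] : exists N, {subset s <= c N}.
  elim: s sc {cs} => [|y s IHs] sc; first by exists 0.
  have [|N sN] := IHs; first by move=> x xs; apply: sc; rewrite inE xs orbT.
  have [M yM] := sc y (mem_head _ _); exists (maxn M N) => x.
  rewrite inE => /predU1P[->|/sN]; first exact: cle (leq_maxl _ _) _ yM.
  exact/cle/leq_maxr.
have [_] := nextP (iter N next (exist _ I (conj iI PI))); apply=> x cx.
by apply: (span_min (ic N) sN); apply: cs; exists N.+1.
Qed.

Lemma artinian_minimal (P : {pred R} -> Prop) I : artinian R ->
  is_ideal I -> P I -> exists J, [/\ is_ideal J, P J
    & forall K, is_ideal K -> P K -> {subset K <= J} -> {subset J <= K}].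
Proof.
move=> aR iI PI; apply: contrapT => noJ.
pose T := {J : {pred R} | is_ideal J /\ P J}.
have /choice[next nextP] : forall J : T, exists K : T,
    {subset sval K <= sval J} /\ ~ {subset sval J <= sval K}.
  move=> [J [iJ PJ]]; apply: contrapT => noK; apply: noJ; exists J; split=> //.
  move=> K iK PK JK; apply: contrapT => KJ; apply: noK.
  by exists (exist _ K (conj iK PK)).
pose c n := sval (iter n next (exist _ I (conj iI PI) : T)).
have [n|n|N cN] := aR c.
- by rewrite /c; case: (iter _ _ _) => ? [].
- by have [] := nextP (iter n next (exist _ I (conj iI PI))).
have [_] := nextP (iter N next (exist _ I (conj iI PI))); apply=> x.
by rewrite -(cN N.+1).
Qed.

End Ideals.

(** * Chain conditions on ideals *)

Section Artinian.
Variable R : comNzRingType.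
Implicit Types (I J K : {pred R}) (s t : seq R) (a b c x y : R).

(** Descending chains of ideals that contain J are the descending chains of
    R / J, so this says that R / J is Artinian without forming the quotient. *)
Definition chains_stabilise J := forall I : nat -> {pred R},
  (forall n, is_ideal (I n)) -> (forall n, {subset I n.+1 <= I n}) ->
  (forall n, {subset J <= I n}) -> exists N, forall n, (N <= n)%N -> I n =i I N.

Lemma descending (I : nat -> {pred R}) : (forall n, {subset I n.+1 <= I n}) ->
  forall m n, (m <= n)%N -> {subset I n <= I m}.
Proof.
move=> IS m n /subnK <-; elim: (n - m)%N => // k IHk x /IS; exact: IHk.
Qed.

(** Multiplication by a identifies R / (J : a) with (J + R a) / J, so R / J is
    an extension of R / (J + R a) by R / (J : a), and an extension of Artinian
    modules is Artinian. *)
Lemma chains_stabilise_extension J a :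
  chains_stabilise (ideal_add J a) -> chains_stabilise (ideal_colon J a) ->
  chains_stabilise J.
Proof.
move=> stabD stabC I iI IS JI.
have [N1 eqD] := stabD (fun n => ideal_add (I n) a)
  (fun n => is_ideal_add a (iI n)) (fun n => ideal_addS (IS n))
  (fun n => ideal_addS (JI n)).
have [N2 eqC] := stabC (fun n => ideal_colon (I n) a)
  (fun n => is_ideal_colon a (iI n)) (fun n => ideal_colonS (IS n))
  (fun n => ideal_colonS (JI n)).
exists (maxn N1 N2) => n; rewrite geq_max => /andP[N1n N2n] x.
set N := maxn N1 N2; have leN : (N <= n)%N by rewrite geq_max N1n.
apply/idP/idP => [|INx]; first exact: (descending IS leN).
have : x \in ideal_add (I n) a.
  by rewrite eqD // -(eqD N) ?leq_maxl //; apply: sub_ideal_add.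
move=> /pred_ofP[c Inxc]; rewrite -[x](subrK (c * a)) idealD //.
have : c \in ideal_colon (I n) a.
  rewrite eqC // -(eqC N) ?leq_maxr //; apply/pred_ofP.
  rewrite -[_ * _](subKr x) idealB //; exact: (descending IS leN).
by move/pred_ofP.
Qed.

(** For a prime I this says that I is maximal. *)
Definition units_modulo I := forall c, c \notin I -> exists d, 1 - c * d \in I.

(** Let J be maximal among the ideals for which R / J is not Artinian.  If a and
    b lie outside J and a * b in J, then J + R a and (J : a), which contains b,
    are both strictly larger than J, so R / J is Artinian by extension.  Hence
    J is prime, so R / J is a field, which is Artinian after all. *)
Lemma noetherian_artinian : noetherian R ->
  (forall J, proper_prime J -> units_modulo J) -> artinian R.
Proof.
move=> nR maxR; suff: chains_stabilise (span [::]).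
  move=> stab I iI IS; apply: stab => // n x /span_nil->; exact: ideal0.
apply: contrapT => nstab.
have [J [iJ nJ maxJ]] := noetherian_maximal (P := fun J => ~ chains_stabilise J)
  nR (is_ideal_span [::]) nstab.
have stabJ K a : is_ideal K -> {subset J <= K} -> a \in K -> a \notin J ->
    chains_stabilise K.
  move=> iK JK Ka Ja; apply: contrapT => nK.
  by case/negP: Ja; apply: (maxJ K).
have J1 : 1 \notin J.
  apply/negP => J1; apply: nJ => I iI IS JI; exists 0 => n _ x.
  have I1 m : x \in I m by rewrite -[x]mulr1 idealM //; apply: JI.
  by rewrite !I1.
have pJ : proper_prime J.
  split=> // a b Jab; apply: contrapT => /not_orP[/negP Ja /negP Jb].
  apply: nJ; apply: (chains_stabilise_extension (a := a)).
    apply: stabJ Ja; [exact: is_ideal_add | exact: sub_ideal_add |].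
    exact: mem_ideal_add.
  apply: stabJ Jb; [exact: is_ideal_colon | exact: sub_ideal_colon |].
  by apply/pred_ofP; rewrite mulrC.
apply: nJ => I iI IS JI; have maxPJ := maxR J pJ.
have [[N IN1]|allI] := pselect (exists N, 1 \notin I N).
  exists N => n Nn x.
  have IJ m : (N <= m)%N -> x \in I m -> x \in J.
    move=> Nm Ix; apply: contrapT => /negP /maxPJ[d Jd]; case/negP: IN1.
    apply: (descending IS Nm); rewrite -[1](subrK (x * d)) idealD //.
      exact: JI.
    by rewrite mulrC idealM.
  by apply/idP/idP => /IJ H; apply/JI/H.
have I1 m x : x \in I m.
  rewrite -[x]mulr1 idealM //; apply: contrapT => /negP Im.
  by apply: allI; exists m.
by exists 0 => n _ x; rewrite !I1.
Qed.

(** The chain of the ideals J + R c^n stops, which gives c^N (1 - c d) in J for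
    some d, while c^N is not in the prime J. *)
Lemma artinian_units_modulo : artinian R -> forall J, proper_prime J -> units_modulo J.
Proof.
move=> aR J [iJ J1 JM] c Jc.
have Jcn n : c ^+ n \notin J.
  elim: n => [|n IHn]; first by rewrite expr0.
  by rewrite exprS; apply/negP => /JM[]; apply/negP.
have [n|n x|N eqN] := aR (fun n => ideal_add J (c ^+ n)).
- exact: is_ideal_add.
- by move=> /pred_ofP[d Jd]; apply/pred_ofP; exists (d * c); rewrite -mulrA -exprS.
have : c ^+ N \in ideal_add J (c ^+ N.+1) by rewrite eqN // mem_ideal_add.
case/pred_ofP => d; have -> : c ^+ N - d * c ^+ N.+1 = c ^+ N * (1 - c * d).
  by rewrite exprS; ring.
by case/JM => [JcN|]; [case/negP: (Jcn N) | exists d].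
Qed.

Definition finitely_generated J :=
  exists2 s, {subset s <= J} & {subset J <= span s}.

(** J is an extension of a * J by the kernel of multiplication by a on J. *)
Lemma finitely_generated_extension J a : is_ideal J ->
  finitely_generated (pred_of (fun x => x \in J /\ a * x = 0)) ->
  finitely_generated (pred_of (fun y => exists2 x, x \in J & y = a * x)) ->
  finitely_generated J.
Proof.
move=> iJ [s sK Ks] [t taJ aJt].
have [|r rJ tE] := @seq_lift _ _ ( *%R a) (fun x => x \in J) t.
  by move=> y /taJ/pred_ofP.
have spanr y : y \in span t -> exists2 z, z \in span r & y = a * z.
  rewrite tE; case/spanP => c ->; rewrite size_map in c *.
  exists (\sum_i c i * r`_i); first by apply/spanP; exists c.
  rewrite big_distrr; apply: eq_bigr => i _ /=.
  by rewrite (nth_map 0) // mulrCA.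
exists (s ++ r) => [x|x Jx].
  by rewrite mem_cat => /orP[/sK/pred_ofP[]|/rJ].
have [z rz axz] := spanr (a * x) (aJt _ (introT (pred_ofP _ _) (ex_intro2 _ _ x Jx erefl))).
rewrite -[x](subrK z); apply: idealD (is_ideal_span _) _ _; last first.
  by apply: sub_span rz => y; rewrite mem_cat orbC => ->.
apply: (@sub_span _ s); first by move=> y; rewrite mem_cat => ->.
apply/Ks/pred_ofP; split; last by rewrite mulrBr axz subrr.
by rewrite idealB //; apply: span_min rz.
Qed.

(** Let J be minimal among the ideals that are not finitely generated.  For
    each a, the kernel and the image of multiplication by a on J cannot both be
    smaller than J, so this map is onto or zero.  The elements that act by zero
    then form a prime P, which is maximal, and J is a vector space over R / P.
    A hyperplane W of J is smaller than J, hence finitely generated, and J is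
    the sum of W and a line: a contradiction. *)
Lemma artinian_noetherian : artinian R -> noetherian R.
Proof.
move=> aR I0 iI0.
suff [s sI Is] : finitely_generated I0 by exists s; apply/generatesP.
apply: contrapT => nfgI0.
have [J [iJ nJ minJ]] :=
  artinian_minimal (P := fun J => ~ finitely_generated J) aR iI0 nfgI0.
have fgJ K : is_ideal K -> {subset K <= J} -> ~ {subset J <= K} ->
    finitely_generated K.
  by move=> iK KJ JK; apply: contrapT => nK; apply: JK; apply: minJ.
pose P := pred_of (fun a => forall x, x \in J -> a * x = 0).
have onto a : a \notin P -> forall y, y \in J -> exists2 x, x \in J & y = a * x.
  move=> Pa y Jy; apply: contrapT => nay; apply: nJ.
  apply: (finitely_generated_extension (a := a)) => //; apply: fgJ.
  - apply: is_ideal_pred_of => [|u v [Ju u0] [Jv v0]|c u [Ju u0]].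
    + by rewrite mulr0 ideal0.
    + by rewrite mulrDr u0 v0 addr0 idealD.
    + by rewrite mulrCA u0 mulr0 idealM.
  - by move=> u /pred_ofP[].
  - by move=> JK; case/negP: Pa; apply/pred_ofP => u /JK/pred_ofP[].
  - apply: is_ideal_pred_of => [|u v [x Jx ->] [z Jz ->]|c u [x Jx ->]].
    + by exists 0; rewrite ?mulr0 ?ideal0.
    + by exists (x + z); rewrite ?mulrDr ?idealD.
    + by exists (c * x); rewrite ?idealM // mulrCA.
  - by move=> u /pred_ofP[x Jx ->]; apply: idealM.
  - by move=> /(_ y Jy)/pred_ofP.
have [x Jx x0] : exists2 x, x \in J & x != 0.
  apply: contrapT => J0; apply: nJ; exists [::] => // x Jx.
  have [->|x0] := eqVneq x 0; first exact: ideal0 (is_ideal_span _).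
  by case: J0; exists x.
have pP : proper_prime P.
  split.
  - apply: is_ideal_pred_of => [u _|a b Pa Pb u Ju|a b Pb u Ju].
    + by rewrite mul0r.
    + by rewrite mulrDl Pa // Pb // addr0.
    + by rewrite -mulrA Pb // mulr0.
  - by apply: contra x0 => /pred_ofP/(_ x Jx); rewrite mul1r => ->.
  - move=> a b Pab; apply: contrapT => /not_orP[/negP Pa /negP Pb].
    have [y Jy xE] := onto a Pa x Jx; have [z Jz yE] := onto b Pb y Jy.
    by move/eqP: x0; apply; rewrite xE yE mulrA; move/pred_ofP: Pab; apply.
have [W [iW WJ xW maxW]] := maximal_avoiding iJ x0.
(* W is a complement of the line R x in the R / P - vector space J *)
have JW : {subset J <= ideal_add W x}.
  move=> y Jy; apply/pred_ofP.
  have [Wy|Wy] := boolP (y \in W); first by exists 0; rewrite mul0r subr0.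
  have /pred_ofP[c Wxc] : x \in ideal_add W y.
    apply: contrapT => /negP xWy; case/negP: Wy.
    apply: (maxW (ideal_add W y)) => //; last exact: mem_ideal_add.
    - exact: is_ideal_add.
    - move=> z /pred_ofP[c /WJ Wz]; rewrite -[z](subrK (c * y)) idealD //.
      exact: idealM.
    - exact: sub_ideal_add.
  have Pc : c \notin P.
    by apply: contra xW => /pred_ofP/(_ y Jy) cy; rewrite cy subr0 in Wxc.
  have [d /pred_ofP/(_ y Jy) cdy] := artinian_units_modulo aR pP Pc.
  exists d; have -> : y - d * x = (1 - c * d) * y - d * (x - c * y) by ring.
  by rewrite cdy sub0r -mulrN -mulN1r idealM // idealM.
have [s sW Ws] : finitely_generated W.
  by apply: fgJ => // JsW; rewrite JsW in xW.
apply: nJ; exists (x :: s) => [y|y /JW/pred_ofP[c /Ws sy]].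
  by rewrite inE => /predU1P[->|/sW/WJ].
by apply/span_cons; exists c.
Qed.

End Artinian.

(** * Localization at a prime *)

Section Localization.
Variables (R : comNzRingType) (p : prime_idealr R).
Implicit Types (x y : R) (s t u : denom p).

Definition frac x s : localization p := \pi_(localization p) (x, s).

Lemma eq_frac x s y t :
  frac x s = frac y t <-> exists u, sval u * (x * sval t) = sval u * (y * sval s).
Proof. exact: iff_sym (eq_localization (x, s) (y, t)). Qed.

Lemma fracD x s y t :
  frac x s + frac y t = frac (x * sval t + y * sval s) (denomM s t).
Proof. exact/esym/(pi_loc_add (x, s) (y, t)). Qed.

Lemma fracM x s y t : frac x s * frac y t = frac (x * y) (denomM s t).
Proof. exact/esym/(pi_loc_mul (x, s) (y, t)). Qed.

Lemma fracP (z : localization p) : exists x s, z = frac x s.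
Proof. by elim/quotW: z => -[x s]; exists x, s. Qed.

Definition loc_map x : localization p := frac x (denom1 p).

Fact loc_map_is_zmod_morphism : zmod_morphism loc_map.
Proof.
move=> x y; rewrite -[in RHS]mulN1r.
have -> : -1 = frac (-1) (denom1 p) by exact/esym/(pi_loc_opp (1, denom1 p)).
rewrite fracM fracD; apply/eq_frac; exists (denom1 p) => /=; ring.
Qed.

Fact loc_map_is_monoid_morphism : monoid_morphism loc_map.
Proof.
split=> // x y; rewrite fracM; apply/eq_frac; exists (denom1 p) => /=; ring.
Qed.

HB.instance Definition _ :=
  GRing.isZmodMorphism.Build R (localization p) loc_map loc_map_is_zmod_morphism.
HB.instance Definition _ :=
  GRing.isMonoidMorphism.Build R (localization p) loc_map loc_map_is_monoid_morphism.

Lemma frac_loc_map x s : frac x s = frac 1 s * loc_map x.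
Proof.
by rewrite fracM; apply/eq_frac; exists (denom1 p) => /=; ring.
Qed.

Lemma loc_map_frac x s : loc_map x = loc_map (sval s) * frac x s.
Proof.
by rewrite fracM; apply/eq_frac; exists (denom1 p) => /=; ring.
Qed.

Definition contraction (I : {pred localization p}) : {pred R} :=
  pred_of (fun x => loc_map x \in I).

Lemma is_ideal_contraction (I : {pred localization p}) : is_ideal I -> is_ideal (contraction I).
Proof.
move=> iI; apply: is_ideal_pred_of => [|x y|a x].
- by rewrite rmorph0 ideal0.
- by rewrite rmorphD; apply: idealD.
- by rewrite rmorphM; apply: idealM.
Qed.

Lemma mem_frac (I : {pred localization p}) x s :
  is_ideal I -> (frac x s \in I) = (x \in contraction I).
Proof.
move=> iI; apply/idP/pred_ofP => [Ixs|Ix]; last by rewrite frac_loc_map idealM.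
by rewrite (loc_map_frac x s) idealM.
Qed.

(** The denominators of finitely many coefficients are cleared one at a time. *)
Lemma span_loc_map (x : R) (a : seq R) : loc_map x \in span (map loc_map a) <->
  exists u, sval u * x \in span a.
Proof.
split=> [|[u ua]].
  elim: a x => [|b a IHa] x /=.
    move=> /span_nil; rewrite -(rmorph0 loc_map) => /eq_frac[u].
    by rewrite !mulr1 mulr0 => ux; exists u; rewrite ux ideal0 //; apply: is_ideal_span.
  case/span_cons => c; have [y [s ->]] := fracP c => xab.
  have /IHa[u au] : loc_map (sval s * x - y * b) \in span (map loc_map a).
    have -> : loc_map (sval s * x - y * b) =
        loc_map (sval s) * (loc_map x - frac y s * loc_map b).
      by rewrite rmorphB !rmorphM mulrBr mulrA -loc_map_frac.
    by apply: idealM xab; apply: is_ideal_span.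
  exists (denomM u s); apply/span_cons; exists (sval u * y) => /=.
  by rewrite -!mulrA -mulrBr.
have -> : loc_map x = frac 1 u * loc_map (sval u * x).
  rewrite -frac_loc_map; apply/eq_frac; exists (denom1 p) => /=; ring.
apply: idealM; first exact: is_ideal_span.
case/spanP: ua => c ->; rewrite rmorph_sum.
apply: (big_ind (fun z => z \in _)).
- exact: ideal0 (is_ideal_span _).
- by move=> y z; apply: idealD (is_ideal_span _).
- move=> i _; rewrite rmorphM idealM //; first exact: is_ideal_span.
  by apply/mem_span/map_f/mem_nth.
Qed.

(** Being Noetherian is read off in R itself: ideals of the localization are
    extended from their contractions, and a list spans such an extension when
    it spans the contraction up to multiplication by elements outside p.  In
    this form the property visibly passes to any smaller prime. *)
Lemma noetherian_localizationP : noetherian (localization p) <->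
  forall J : {pred R}, is_ideal J -> exists2 a : seq R, {subset a <= J} &
    forall x, x \in J -> exists u : denom p, sval u * x \in span a.
Proof.
split=> [nR J iJ|fgR I iI].
  have [t tJ Jt] := noetherian_generated nR (fun z => exists2 x, x \in J & z = loc_map x).
  have [a aJ tE] := seq_lift tJ; exists a => // x Jx.
  by apply/span_loc_map; rewrite -tE; apply: Jt; exists x.
have [a aI Ia] := fgR _ (is_ideal_contraction iI).
exists (map loc_map a); apply/generatesP => //; split=> z.
  by case/mapP=> x /aI/pred_ofP ? ->.
have [x [s ->]] := fracP z; rewrite mem_frac // => /Ia/span_loc_map.
by rewrite frac_loc_map; apply: idealM (is_ideal_span _).
Qed.

Lemma contraction_proper_prime (I : {pred localization p}) :
  proper_prime I -> proper_prime (contraction I) /\ {subset contraction I <= p}.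
Proof.
move=> [iI I1 IM].
have Ip : {subset contraction I <= p}.
  move=> x Ix; apply: contraNT I1 => px.
  have -> : 1 = frac x (exist _ x px).
    by rewrite -(rmorph1 loc_map); apply/eq_frac; exists (denom1 p) => /=; ring.
  by rewrite mem_frac.
split=> //; split; first exact: is_ideal_contraction.
  by apply: contra I1 => /pred_ofP; rewrite rmorph1.
by move=> x y /pred_ofP; rewrite rmorphM => /IM[]; [left|right]; apply/pred_ofP.
Qed.

(** A prime of the localization contracts to a prime inside p, that is to p, so
    the numerator of a fraction outside it is a denominator. *)
Lemma minimal_prime_localization : minimal_prime p ->
  forall I : {pred localization p}, proper_prime I -> units_modulo I.
Proof.
move=> minp I pI; have [pJ Jp] := contraction_proper_prime pI.
have [iI I1 IM] := pI; have [q qE] := prime_idealr_of pJ.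
have pE : p =i contraction I.
  by move=> x; rewrite -qE minp // => y; rewrite qE; apply: Jp.
move=> z; have [x [s ->]] := fracP z.
rewrite mem_frac // -pE => px; exists (frac (sval s) (exist _ x px)).
have -> : frac x s * frac (sval s) (exist _ x px) = 1.
  by rewrite fracM -(rmorph1 loc_map); apply/eq_frac; exists (denom1 p) => /=; ring.
by rewrite subrr ideal0.
Qed.

End Localization.

(** Below p there is a minimal prime q.  The localization at q is still
    Noetherian and all its primes are maximal, so it is Artinian. *)
Lemma artinian_minimal_localization (R : comNzRingType) (p : prime_idealr R) :
  noetherian (localization p) ->
  exists q : prime_idealr R, minimal_prime q /\ artinian (localization q).
Proof.
move=> /noetherian_localizationP np.
have [I [pI Ip minI]] := exists_minimal_prime (proper_prime_idealr p).
have [q qE] := prime_idealr_of pI.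
have minq : minimal_prime q.
  move=> r rq x; rewrite qE; apply: minI; first exact: proper_prime_idealr.
  by move=> y /rq; rewrite qE.
exists q; split=> //; apply: noetherian_artinian; last exact: minimal_prime_localization.
apply/noetherian_localizationP => J /np[a aJ Ja]; exists a => // x /Ja[u ua].
have qu : sval u \notin q by apply: contra (svalP u); rewrite qE => /Ip.
by exists (exist _ (sval u) qu).
Qed.

(** * Tensor products and the descent of generators along a flat map *)

Section Tensors.
Variables (R : comNzRingType) (M N : lmodType R).
Implicit Types (m : M) (n : N) (a : R).

Definition tens m n : tensor M N := \pi_(tensor M N) [:: (m, n)].

Lemma tensDl m m' n : tens (m + m') n = tens m n + tens m' n.
Proof.
rewrite -[RHS](pi_tensor_add [:: (m, n)] [:: (m', n)]).
exact/eq_tensor/tensor_eqDl.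
Qed.

Lemma tensDr m n n' : tens m (n + n') = tens m n + tens m n'.
Proof.
rewrite -[RHS](pi_tensor_add [:: (m, n)] [:: (m, n')]).
exact/eq_tensor/tensor_eqDr.
Qed.

Lemma tensZ a m n : tens (a *: m) n = tens m (a *: n).
Proof. exact/eq_tensor/tensor_eqZ. Qed.

Lemma tens0l n : tens 0 n = 0.
Proof. exact/eq_tensor/tensor_eq0l. Qed.

Lemma tens0r m : tens m 0 = 0.
Proof. by rewrite -(scale0r 0) -tensZ scale0r tens0l. Qed.

Lemma tensor_ind (P : tensor M N -> Prop) :
  P 0 -> (forall m n v, P v -> P (tens m n + v)) -> forall v, P v.
Proof.
move=> P0 Ptens; elim/quotW; elim=> [|[m n] s IHs]; first exact: P0.
by rewrite -[_ :: s]/([:: (m, n)] ++ s) pi_tensor_add; apply: Ptens.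
Qed.

Section Lift.
Variables (L : zmodType) (B : M -> N -> L).
Hypothesis BDl : forall m m' n, B (m + m') n = B m n + B m' n.
Hypothesis BDr : forall m n n', B m (n + n') = B m n + B m n'.
Hypothesis BZ : forall a m n, B (a *: m) n = B m (a *: n).

Lemma tensor_eq_sum s t : tensor_eq s t ->
  \sum_(x <- s) B x.1 x.2 = \sum_(x <- t) B x.1 x.2.
Proof.
elim=> {s t} [s|s t _|s t u _ IH1 _|s s' t t' _ IH1 _ IH2|s t|n|m m' n|m n n'|a m n] //.
- by rewrite IH1.
- by rewrite !big_cat /= IH1 IH2.
- by rewrite !big_cat /= addrC.
- by rewrite big_seq1 big_nil /=; apply: (addrI (B 0 n)); rewrite -BDl !addr0.
- by rewrite !big_cons !big_nil /= !addr0 BDl.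
- by rewrite !big_cons !big_nil /= !addr0 BDr.
- by rewrite !big_seq1 /= BZ.
Qed.

(** The universal property, for balanced biadditive maps to an abelian group.
    It is the only means by which elements of a tensor product are told
    apart. *)
Lemma tensor_lift : exists F : tensor M N -> L,
  [/\ F 0 = 0, forall v w, F (v + w) = F v + F w & forall m n, F (tens m n) = B m n].
Proof.
pose F (v : tensor M N) := \sum_(x <- repr v) B x.1 x.2.
have FE s : F (\pi s) = \sum_(x <- s) B x.1 x.2.
  exact/tensor_eq_sum/repr_tensor_eq.
exists F; split=> [|v w|m n].
- by rewrite -[0]/(\pi_(tensor M N) [::]) FE big_nil.
- elim/quotW: v => s; elim/quotW: w => t.
  by rewrite -[_ + _](pi_tensor_add s t) !FE big_cat.
- by rewrite FE big_seq1.
Qed.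

End Lift.
End Tensors.

Section TensorMapTheory.
Variables (R : comNzRingType) (M M' N : lmodType R) (f : {linear M -> M'}).

Lemma tensor_map_tens m n : tensor_map N f (tens m n) = tens (f m) n.
Proof. exact: tensor_mapE. Qed.

Lemma tensor_map0 : tensor_map N f 0 = 0.
Proof. exact: linear0. Qed.

Lemma tensor_mapD : {morph tensor_map N f : u v / u + v}.
Proof. exact: linearD. Qed.

Lemma tensor_map_sum (I : finType) (F : I -> tensor M N) :
  tensor_map N f (\sum_i F i) = \sum_i tensor_map N f (F i).
Proof. exact: (big_morph _ tensor_mapD tensor_map0). Qed.

End TensorMapTheory.

Section Kernel.
Variables (R : comNzRingType) (V W : lmodType R) (g : {linear V -> W}).

Definition in_kernel : {pred V} := fun v => g v == 0.

Fact in_kernel_submod_closed : submod_closed in_kernel.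
Proof.
split=> [|a u v /eqP gu /eqP gv]; first by rewrite unfold_in linear0.
by rewrite unfold_in linearP gu gv scaler0 addr0.
Qed.
HB.instance Definition _ :=
  GRing.isSubmodClosed.Build R V in_kernel in_kernel_submod_closed.

(** The kernel as a module of its own, needed as the source of an exact pair. *)
Record kernel := Kernel {kernel_val : V; _ : kernel_val \in in_kernel}.
HB.instance Definition _ := [isSub for kernel_val].
HB.instance Definition _ := [Choice of kernel by <:].
HB.instance Definition _ := [SubChoice_isSubLmodule of kernel by <:].

Lemma exact_kernel : exact_at (\val : {linear kernel -> V}) g.
Proof.
move=> y; split=> [/eqP gy|[[x gx] ->]]; first by exists (Kernel gy).
exact/eqP.
Qed.

End Kernel.

(** Flatness carries the conductor of x into the span of a to the conductor of
    phi x into the extended span; the latter is the unit ideal when phi x lies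
    in the extended span.  To see this, write phi x as the sum of the
    c_i phi a_i and let g map (v_0, v_1, ..., v_n) in R^(1+n) to
    v_0 x + v_1 a_1 + ... + v_n a_n.  The tensor y = e_0 (x) 1 - sum e_i (x) c_i
    is killed by g (x) id, so by flatness it comes from the kernel of g.  The
    0-th coordinate of y is 1, and the 0-th coordinates of the vectors in the
    kernel lie in the conductor of x.  The extension of that conductor to S is
    represented by an arbitrary ideal Q of S that contains its image. *)
Lemma flat_transporter (R S : comNzRingType) (phi : {rmorphism R -> S})
    (x : R) (a : seq R) (Q : {pred S}) :
  flat_map phi -> phi x \in span (map phi a) -> is_ideal Q ->
  (forall b, b * x \in span a -> phi b \in Q) -> 1 \in Q.
Proof.
move=> flat_phi /spanP; rewrite size_map => -[c phix] iQ QP.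
set n := size a in c phix.
(* r and N only retype S as an R-module *)
pose N := restriction phi; pose r (z : S) : N := z.
have rZ b z : b *: r z = r (phi b * z) by [].
pose C : 'cV[R]_(1 + n) := col_mx x%:M (\col_i a`_i).
pose g : {linear 'rV[R]_(1 + n) -> 'rV[R]_1} := mulmxr C.
pose e0 : 'rV[R]_(1 + n) := row_mx 1%:M 0.
pose e (i : 'I_n) : 'rV[R]_(1 + n) := row_mx 0 (delta_mx 0 i).
pose y : tensor 'rV[R]_(1 + n) N := tens e0 (r 1) + \sum_i tens (e i) (r (- c i)).
have ge0 : g e0 = x *: 1%:M.
  by rewrite /= mul_row_col mul1mx mul0mx addr0 scalemx1.
have ge i : g (e i) = a`_i *: 1%:M.
  rewrite /= mul_row_col mul0mx add0r -rowE scalemx1; apply/matrixP => j k.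
  by rewrite !mxE !ord1.
have gy : tensor_map N g y = 0.
  rewrite tensor_mapD tensor_map_sum tensor_map_tens ge0 tensZ.
  under eq_bigr do rewrite tensor_map_tens ge tensZ rZ.
  rewrite rZ mulr1 phix.
  have tens_sum (F : 'I_n -> S) : tens (1%:M : 'rV[R]_1) (r (\sum_i F i)) =
      \sum_i tens 1%:M (r (F i)).
    apply: (big_morph (fun z => tens 1%:M (r z))) => [u v|]; last exact: tens0r.
    exact: tensDr.
  rewrite tens_sum -big_split big1 // => i _ /=.
  rewrite -tensDr (nth_map 0) // -[_ + _]/(r (_ + _)) mulrN mulrC subrr.
  exact: tens0r.
have [w yE] : exists w, y = tensor_map N (\val : {linear kernel g -> _}) w.
  exact/(flat_phi _ _ _ _ _ (exact_kernel g) y).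
(* F is the 0-th coordinate map from R^(1+n) (x) S to S *)
pose B (v : 'rV[R]_(1 + n)) (z : N) : S := phi (v 0 0) * z.
have [|||F [F0 FD FB]] := @tensor_lift R 'rV[R]_(1 + n) N S B.
- by move=> u v z; rewrite /B mxE rmorphD mulrDl.
- by move=> v z z'; exact: mulrDr.
- by move=> b v z; rewrite /B mxE rmorphM -mulrA mulrCA.
have v00 (u : 'rV[R]_1) (v : 'rV[R]_n) : (row_mx u v : 'rV[R]_(1 + n)) 0 0 = u 0 0.
  by rewrite -(row_mxEl u v 0 0); congr (row_mx u v 0 _); apply: val_inj.
have <- : F y = 1.
  have Fsum (G : 'I_n -> tensor 'rV[R]_(1 + n) N) :
    F (\sum_i G i) = \sum_i F (G i) by apply: big_morph.
  rewrite FD FB /B v00 !mxE rmorph1 mul1r Fsum big1 ?addr0 // => i _.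
  by rewrite FB /B v00 mxE rmorph0 mul0r.
rewrite yE; elim/tensor_ind: w {yE} => [|k z w IHw].
  by rewrite tensor_map0 F0 ideal0.
rewrite tensor_mapD FD tensor_map_tens FB; apply: idealD => //.
rewrite /B mulrC idealM //; apply: QP; case: k => v /= /eqP gv.
have {gv} : (lsubmx v *m x%:M + rsubmx v *m \col_i a`_i) 0 0 = 0.
  by rewrite -mul_row_col hsubmxK [_ *m _]gv mxE.
rewrite mul_mx_scalar !mxE => /eqP; rewrite addr_eq0 => /eqP vx.
have -> : v 0 0 * x = - \sum_j rsubmx v 0 j * a`_j.
  rewrite mulrC; transitivity (x * v 0 (lshift n 0)).
    by congr (_ * v 0 _); apply: val_inj.
  by rewrite vx; congr (- _); apply: eq_bigr => j _; rewrite [(\col_i _) j 0]mxE.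
rewrite -mulN1r; apply: idealM; first exact: is_ideal_span.
by apply/spanP; exists (fun j => rsubmx v 0 j).
Qed.

(** p is the contraction of any prime Q of S.  For an ideal J of R, the ideal
    J S is generated by images of finitely many a_i in J.  For x in J, the
    conductor of x into (a_i) generates the unit ideal of S, so it is not
    contained in p, and x is in the span of the a_i up to an element outside
    p. *)
Lemma noetherian_localization_of_star (R : comNzRingType) :
  property_star R -> exists p : prime_idealr R, noetherian (localization p).
Proof.
move=> [S [phi [nS flat_phi]]].
have [Q [iQ Q1 QM]] := exists_prime S.
have pP : proper_prime (pred_of (fun b => phi b \in Q)).
  split.
  - apply: is_ideal_pred_of => [|x y|a x].
    + by rewrite rmorph0 ideal0.
    + by rewrite rmorphD; apply: idealD.
    + by rewrite rmorphM; apply: idealM.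
  - by apply: contra Q1 => /pred_ofP; rewrite rmorph1.
  - by move=> x y /pred_ofP; rewrite rmorphM => /QM[]; [left|right]; apply/pred_ofP.
have [p pE] := prime_idealr_of pP.
exists p; apply/noetherian_localizationP => J iJ.
have [t tJ Jt] := noetherian_generated nS (fun z => exists2 x, x \in J & z = phi x).
have [a aJ tE] := seq_lift tJ; exists a => // x Jx.
have xa : phi x \in span (map phi a) by rewrite -tE; apply: Jt; exists x.
apply: contrapT => nx; case/negP: Q1.
apply: (flat_transporter flat_phi xa iQ) => b ba.
apply/(pred_ofP (fun b => phi b \in Q)); rewrite -pE; apply: contrapT => /negP pb.
by apply: nx; exists (exist _ b pb).
Qed.

(** * Flatness of localization *)

Section LocalizedModule.
Variables (R : comNzRingType) (p : prime_idealr R) (M : lmodType R).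
Implicit Types (m : M) (s t u : denom p) (f g h : M * denom p).

(** Equality of fractions in the localization of M at p, which is the target of
    a balanced map that detects when an elementary tensor m (x) 1/s vanishes. *)
Definition mfrac_eq f g : Prop :=
  exists u, (sval u * sval g.2) *: f.1 = (sval u * sval f.2) *: g.1.

Definition mfrac_eqb f g : bool := `[< mfrac_eq f g >].

Fact mfrac_eqb_refl : reflexive mfrac_eqb.
Proof. by move=> f; apply/asboolP; exists (denom1 p). Qed.

Fact mfrac_eqb_sym : symmetric mfrac_eqb.
Proof. by move=> f g; apply/asboolP/asboolP => -[u e]; exists u. Qed.

Fact mfrac_eqb_trans : transitive mfrac_eqb.
Proof.
move=> g f h /asboolP[u fg] /asboolP[v gh]; apply/asboolP.
exists (denomM (denomM u v) g.2) => /=.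
transitivity ((sval v * sval h.2) *: ((sval u * sval g.2) *: f.1)).
  by rewrite scalerA; congr (_ *: _); ring.
rewrite fg scalerA.
transitivity ((sval u * sval f.2) *: ((sval v * sval h.2) *: g.1)).
  by rewrite scalerA; congr (_ *: _); ring.
by rewrite gh scalerA; congr (_ *: _); ring.
Qed.

Canonical mfrac_equiv :=
  EquivRel mfrac_eqb mfrac_eqb_refl mfrac_eqb_sym mfrac_eqb_trans.

Definition loc_module : Type := {eq_quot mfrac_eqb}.
HB.instance Definition _ : EqQuotient _ mfrac_eqb loc_module :=
  EqQuotient.on loc_module.
HB.instance Definition _ := Choice.on loc_module.

Lemma eq_loc_module f g : mfrac_eq f g <-> \pi_loc_module f = \pi_loc_module g.
Proof. by split=> [e|/eqmodP/asboolP//]; apply/eqmodP/asboolP. Qed.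

Fact repr_mfrac_eq f : mfrac_eq (repr (\pi_loc_module f)) f.
Proof. by apply/eq_loc_module; rewrite reprK. Qed.

Definition mfrac m s : loc_module := \pi_loc_module (m, s).

Lemma eq_mfrac m s n t : mfrac m s = mfrac n t <->
  exists u, (sval u * sval t) *: m = (sval u * sval s) *: n.
Proof. exact: iff_sym (eq_loc_module (m, s) (n, t)). Qed.

Definition mfrac_add f g : M * denom p :=
  (sval g.2 *: f.1 + sval f.2 *: g.1, denomM f.2 g.2).
Definition mfrac_opp f : M * denom p := (- f.1, f.2).

Definition loc_module_add := lift_op2 loc_module mfrac_add.
Definition loc_module_opp := lift_op1 loc_module mfrac_opp.

Fact loc_module_addE m s n t : loc_module_add (mfrac m s) (mfrac n t) =
  mfrac (sval t *: m + sval s *: n) (denomM s t).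
Proof.
rewrite /loc_module_add; unlock; rewrite /mfrac_add.
case: (repr_mfrac_eq (m, s)); rewrite -/(mfrac m s); move: (repr _) => -[m' s'] u /= e1.
case: (repr_mfrac_eq (n, t)); rewrite -/(mfrac n t); move: (repr _) => -[n' t'] v /= e2.
apply/eq_mfrac; exists (denomM u v) => /=.
rewrite !scalerDr !scalerA; congr (_ + _).
  transitivity ((sval v * sval t * sval t') *: ((sval u * sval s) *: m')).
    by rewrite scalerA; congr (_ *: _); ring.
  by rewrite e1 scalerA; congr (_ *: _); ring.
transitivity ((sval u * sval s * sval s') *: ((sval v * sval t) *: n')).
  by rewrite scalerA; congr (_ *: _); ring.
by rewrite e2 scalerA; congr (_ *: _); ring.
Qed.

Fact loc_module_oppE m s : loc_module_opp (mfrac m s) = mfrac (- m) s.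
Proof.
rewrite /loc_module_opp; unlock; rewrite /mfrac_opp.
case: (repr_mfrac_eq (m, s)); rewrite -/(mfrac m s); move: (repr _) => -[m' s'] u /= e.
by apply/eq_mfrac; exists u; rewrite !scalerN e.
Qed.

Lemma mfracP (z : loc_module) : exists m s, z = mfrac m s.
Proof. by elim/quotW: z => -[m s]; exists m, s. Qed.

Fact loc_module_addA : associative loc_module_add.
Proof.
move=> x y z; have [m [s ->]] := mfracP x.
have [n [t ->]] := mfracP y; have [k [u ->]] := mfracP z.
rewrite !loc_module_addE; apply/eq_mfrac; exists (denom1 p) => /=.
by rewrite !scalerDr !scalerA addrA; congr (_ *: _ + _ *: _ + _ *: _); ring.
Qed.

Fact loc_module_addC : commutative loc_module_add.
Proof.
move=> x y; have [m [s ->]] := mfracP x; have [n [t ->]] := mfracP y.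
rewrite !loc_module_addE; apply/eq_mfrac; exists (denom1 p) => /=.
by rewrite addrC [sval s * _]mulrC.
Qed.

Fact loc_module_add0 : left_id (mfrac 0 (denom1 p)) loc_module_add.
Proof.
move=> x; have [m [s ->]] := mfracP x; rewrite loc_module_addE.
by apply/eq_mfrac; exists (denom1 p) => /=; rewrite scaler0 add0r scale1r !mul1r.
Qed.

Fact loc_module_addN : left_inverse (mfrac 0 (denom1 p)) loc_module_opp loc_module_add.
Proof.
move=> x; have [m [s ->]] := mfracP x; rewrite loc_module_oppE loc_module_addE.
by apply/eq_mfrac; exists (denom1 p) => /=; rewrite scalerN addNr !scaler0.
Qed.

HB.instance Definition _ := GRing.isZmodule.Build loc_module
  loc_module_addA loc_module_addC loc_module_add0 loc_module_addN.

Lemma mfracD m s n t :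
  mfrac m s + mfrac n t = mfrac (sval t *: m + sval s *: n) (denomM s t).
Proof. exact: loc_module_addE. Qed.

Lemma mfrac_eq0 m s : mfrac m s = 0 -> exists u : denom p, sval u *: m = 0.
Proof. by move=> /eq_mfrac[u]; rewrite /= mulr1 scaler0 => um; exists u. Qed.

Definition scale_frac m (z : localization p) : loc_module :=
  mfrac ((repr z).1 *: m) (repr z).2.

Lemma scale_fracE m a s : scale_frac m (frac a s) = mfrac (a *: m) s.
Proof.
have [u] := repr_fracs_eq (a, s); rewrite -/(frac a s) /= => e.
by apply/eq_mfrac; exists u; rewrite !scalerA -!mulrA ![sval _ * (repr _).1]mulrC
  ![sval (repr _).2 * a]mulrC e.
Qed.

End LocalizedModule.

Section FlatLocalization.
Variables (R : comNzRingType) (p : prime_idealr R).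
Let N := restriction (@loc_map R p).

(** A fraction retyped in the restriction of scalars, so that R scales it. *)
Definition lfrac (x : R) (s : denom p) : restriction (@loc_map R p) := frac x s.

Lemma scale_lfrac a x s : a *: lfrac x s = lfrac (a * x) s.
Proof.
by rewrite -[LHS]/(loc_map p a * frac x s) fracM; apply/eq_frac; exists (denom1 p) => /=; ring.
Qed.

Lemma lfracD x s y t :
  lfrac x s + lfrac y t = lfrac (x * sval t + y * sval s) (denomM s t).
Proof. exact: fracD. Qed.

Lemma lfrac_mulr x s t : lfrac x s = lfrac (sval t * x) (denomM s t).
Proof. by apply/eq_frac; exists (denom1 p) => /=; ring. Qed.

(** Finitely many fractions have a common denominator, which can be moved
    through the tensor sign onto the numerators. *)
Lemma tensor_common_denom (M : lmodType R) (v : tensor M N) :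
  exists m s, v = tens m (lfrac 1 s).
Proof.
elim/tensor_ind: v => [|m z _ [n [t ->]]].
  by exists 0, (denom1 p); rewrite tens0l.
have [a [s ->]] := fracP z; rewrite -/(lfrac a s).
exists ((sval t * a) *: m + sval s *: n), (denomM s t).
rewrite tensDl !tensZ !scale_lfrac !mulr1 (lfrac_mulr a s t); congr (_ + tens _ _).
by apply/eq_frac; exists (denom1 p) => /=; ring.
Qed.

Lemma tens_frac_eq0 (M : lmodType R) m s : tens m (lfrac 1 s) = 0 :> tensor M N ->
  exists u : denom p, sval u *: m = 0.
Proof.
have [|||F [F0 _ FB]] := @tensor_lift R M N (loc_module p M) (fun m z => scale_frac m z).
- move=> m1 m2 z; have [a [t ->]] := fracP z; rewrite !scale_fracE mfracD.
  apply/eq_mfrac; exists (denom1 p) => /=; rewrite !scalerDr !scalerA.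
  by congr (_ *: _ + _ *: _); ring.
- move=> n z1 z2; have [a [t ->]] := fracP z1; have [b [u ->]] := fracP z2.
  rewrite -/(lfrac a t) -/(lfrac b u) lfracD !scale_fracE mfracD !scalerA -scalerDl.
  by apply/eq_mfrac; exists (denom1 p) => /=; rewrite !scalerA; congr (_ *: _); ring.
- move=> b n z; have [a [t ->]] := fracP z; rewrite -/(lfrac a t) scale_lfrac.
  rewrite !scale_fracE scalerA; congr mfrac; congr (_ *: _); ring.
by move=> /(congr1 F); rewrite FB F0 scale_fracE scale1r; apply: mfrac_eq0.
Qed.

(** An element of M2 (x) R_p is of the form m (x) 1/s.  If its image vanishes
    then u * g m = 0 for some u outside p, so that u m = f m1 by exactness and
    m (x) 1/s = f m1 (x) 1/(u s). *)
Lemma flat_localization : flat_map (@loc_map R p).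
Proof.
move=> M1 M2 M3 f g fg v; split.
  have [m [s ->]] := tensor_common_denom v.
  move=> gv; have : tensor_map N g (tens m (lfrac 1 s)) = 0 by exact: gv.
  rewrite tensor_map_tens => /tens_frac_eq0[u].
  rewrite -linearZ => /fg[m1 um]; exists (tens m1 (lfrac 1 (denomM u s))).
  transitivity (tensor_map N f (tens m1 (lfrac 1 (denomM u s)))) => //.
  rewrite tensor_map_tens -um tensZ scale_lfrac; congr tens.
  by apply/eq_frac; exists (denom1 p) => /=; ring.
move=> [w vE]; have {vE}-> : v = tensor_map N f w by exact: vE.
suff : tensor_map N g (tensor_map N f w) = 0 by [].
elim/tensor_ind: w => [|m z w IHw]; first by rewrite !tensor_map0.
rewrite !tensor_mapD IHw addr0 !tensor_map_tens.
have -> : g (f m) = 0 by apply/fg; exists m.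
exact: tens0l.
Qed.

End FlatLocalization.

Theorem theorem5 (R : comNzRingType) :
  [<-> property_star R;
       exists p : prime_idealr R, noetherian (localization p);
       exists p : prime_idealr R, minimal_prime p /\ artinian (localization p)].
Proof.
split; last split.
- exact: noetherian_localization_of_star.
- by case=> p; apply: artinian_minimal_localization.
- move=> [p [_ aR]]; exists (localization p), (@loc_map R p).
  by split; [apply: artinian_noetherian | apply: flat_localization].
Qed.
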